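(* Let $H,r,m\ge1$, $d=(H+1)r+Hm$, and consider the sequence-based control-affine model $$\boldsymbol{\xi}_{k+1}=\boldsymbol{\alpha}(\boldsymbol{\xi}_k)+\boldsymbol{\beta}(\boldsymbol{\xi}_k)\,\mathbf{u}_k,$$ with $\boldsymbol{\xi}_k\in\mathbb{R}^d$, $\mathbf{u}_k\in\mathbb{R}^m$ and $\boldsymbol{\alpha},\boldsymbol{\beta}$ as defined in the context through maps $\widetilde{\mathbf{a}}_{\varphi_1}:\mathbb{R}^d\to\mathbb{R}^r$ and $\widetilde{\mathbf{B}}_{\varphi_2}:\mathbb{R}^d\to\mathbb{R}^{r\times m}$. Let $\mathbf{y}_k=\mathbf{C}\boldsymbol{\xi}_k=\mathbf{z}_k$ define the output equation, where $\mathbf{C}\in\mathbb{R}^{r\times d}$ extracts the last $r$ components of $\boldsymbol{\xi}_k$. Let $\mathcal{D}\subset\mathbb{R}^d$ be a domain of interest, and let $\bar{\mathbf{A}}\in\mathbb{R}^{r\times r}$, $\bar{\mathbf{B}}\in\mathbb{R}^{r\times m}$ define the desired latent output dynamics $\mathbf{y}_{k+1}=\bar{\mathbf{A}}\mathbf{y}_k+\bar{\mathbf{B}}\mathbf{v}_k$. If $\operatorname{rank}(\widetilde{\mathbf{B}}_{\varphi_2}(\boldsymbol{\xi}_k))=r$ for all $\boldsymbol{\xi}_k\in\mathcal{D}$, then exact input-output feedback linearization from a virtual input $\mathbf{v}_k\in\mathbb{R}^m$ to the subsequent output $\mathbf{y}_{k+1}\in\mathbb{R}^r$ is achievable. Under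 this condition, the linearizing feedback law is given by $$\mathbf{u}_k=\widetilde{\mathbf{B}}^{R}_{\varphi_2}(\boldsymbol{\xi}_k)\big(\bar{\mathbf{A}}\mathbf{y}_k+\bar{\mathbf{B}}\mathbf{v}_k-\widetilde{\mathbf{a}}_{\varphi_1}(\boldsymbol{\xi}_k)\big),$$ where $\widetilde{\mathbf{B}}^{R}_{\varphi_2}$ denotes the right pseudoinverse of $\widetilde{\mathbf{B}}_{\varphi_2}$.
   Context: Latent states are $\mathbf{z}_j\in\mathbb{R}^r$ and inputs are $\mathbf{u}_j\in\mathbb{R}^m$. For a history length $H$, the extended state vector is $$\boldsymbol{\xi}_k=[\mathbf{z}_{k-H}^T,\dots,\mathbf{z}_{k-1}^T,\mathbf{u}_{k-H}^T,\dots,\mathbf{u}_{k-1}^T,\mathbf{z}_k^T]^T\in\mathbb{R}^d,\qquad d=(H+1)r+Hm.$$ The maps $\boldsymbol{\alpha}:\mathbb{R}^d\to\mathbb{R}^d$ and $\boldsymbol{\beta}:\mathbb{R}^d\to\mathbb{R}^{d\times m}$ are $$\boldsymbol{\alpha}(\boldsymbol{\xi}_k)=\mathbf{S}\boldsymbol{\xi}_k+\begin{bmatrix}\mathbf{0}_{Hr+Hm}\\ \widetilde{\mathbf{a}}_{\varphi_1}(\boldsymbol{\xi}_k)\end{bmatrix},\qquad \boldsymbol{\beta}(\boldsymbol{\xi}_k)=\begin{bmatrix}\mathbf{0}_{Hr\times m}\\ \mathbf{0}_{(H-1)m\times m}\\ \mathbf{I}_{m\times m}\\ \widetilde{\mathbf{B}}_{\varphi_2}(\boldsymbol{\xi}_k)\end{bmatrix}.$$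 Here $\mathbf{S}\in\mathbb{R}^{d\times d}$ is the block-shift matrix that advances the memory sequences by one time step; with respect to the partition of $\boldsymbol{\xi}_k$ into state history (size $Hr$), input history (size $Hm$) and current state (size $r$), $$\mathbf{S}=\begin{bmatrix}\mathbf{S}_z&\mathbf{0}_{Hr\times Hm}&\mathbf{E}_z\\ \mathbf{0}_{Hm\times Hr}&\mathbf{S}_u&\mathbf{0}_{Hm\times r}\\ \mathbf{0}_{r\times Hr}&\mathbf{0}_{r\times Hm}&\mathbf{0}_{r\times r}\end{bmatrix},$$ where $\mathbf{S}_z\in\mathbb{R}^{Hr\times Hr}$ and $\mathbf{S}_u\in\mathbb{R}^{Hm\times Hm}$ are block matrices with $H\times H$ blocks having identity blocks ($\mathbf{I}_{r\times r}$, respectively $\mathbf{I}_{m\times m}$) on the first block superdiagonal and zeros elsewhere, and $\mathbf{E}_z\in\mathbb{R}^{Hr\times r}$ has $\mathbf{I}_{r\times r}$ in its bottom block row and zeros elsewhere. Exact input-output feedback linearization means: there is a feedback law expressing $\mathbf{u}_k$ as a function of $\boldsymbol{\xi}_k$ and the virtual input $\mathbf{v}_k$ such that, for all $\boldsymbol{\xi}_k\in\mathcal{D}$ and all $\mathbf{v}_k\in\mathbb{R}^m$, the next output $\mathbf{y}_{k+1}=\mathbf{C}\boldsymbol{\xi}_{k+1}$ satisfies $\mathbf{y}_{k+1}=\bar{\mathbf{A}}\mathbf{y}_k+\bar{\mathbf{B}}\mathbf{v}_k$. The right pseudoinverse of a full-row-rank matrix $\mathbf{B}\in\mathbb{R}^{r\times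 m}$ is $\mathbf{B}^{R}=\mathbf{B}^T(\mathbf{B}\mathbf{B}^T)^{-1}$, which satisfies $\mathbf{B}\mathbf{B}^{R}=\mathbf{I}_{r\times r}$ and equals $\mathbf{B}^{-1}$ when $r=m$. *)

(* Defs.v *)
From mathcomp Require Import all_boot all_order all_algebra.
From mathcomp Require Import all_classical reals.

Set Implicit Arguments.
Unset Strict Implicit.
Unset Printing Implicit Defensive.

Import GRing.Theory.

Local Open Scope ring_scope.

(* The dimension d is kept in the form of the partition into state history,
   input history and current state. *)
Notation ext_dim H r m := (H * r + H * m + r)%N.

Lemma ext_dimE (H r m : nat) : ext_dim H r m = (H.+1 * r + H * m)%N.
Proof. by rewrite mulSn addnAC [(r + _)%N]addnC. Qed.

Lemma sum_blocks (H n : nat) : (\sum_(i < H) n)%N = (H * n)%N.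
Proof. by rewrite sum_nat_const card_ord. Qed.

(* S_z is [shift_mx R H r] and S_u is [shift_mx R H m]. *)
Definition shift_mx (R : realType) (H n : nat) : 'M[R]_(H * n) :=
  castmx (sum_blocks H n, sum_blocks H n)
    (\mxblock_(i < H, j < H)
       (if (j == i.+1 :> nat) then 1%:M else 0 : 'M[R]_n)).

(* Identity in the bottom block row, zeros elsewhere.  E_z is
   [last_block_mx R H r], and [last_block_mx R H m] is the part
   [0_{(H-1)m x m}; I_m] of beta. *)
Definition last_block_mx (R : realType) (H n : nat) : 'M[R]_(H * n, n) :=
  castmx (sum_blocks H n, erefl n)
    (\mxcol_(i < H) (if (i.+1 == H :> nat) then 1%:M else 0 : 'M[R]_n)).

Definition block_shift (R : realType) (H r m : nat) : 'M[R]_(ext_dim H r m) :=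
  block_mx
    (block_mx (shift_mx R H r) 0 0 (shift_mx R H m))
    (col_mx (last_block_mx R H r) 0)
    0 0.

Definition alpha (R : realType) (H r m : nat)
    (a : 'cV[R]_(ext_dim H r m) -> 'cV[R]_r)
    (xi : 'cV[R]_(ext_dim H r m)) : 'cV[R]_(ext_dim H r m) :=
  block_shift R H r m *m xi + col_mx 0 (a xi).

Definition beta (R : realType) (H r m : nat)
    (B : 'cV[R]_(ext_dim H r m) -> 'M[R]_(r, m))
    (xi : 'cV[R]_(ext_dim H r m)) : 'M[R]_(ext_dim H r m, m) :=
  col_mx (col_mx 0 (last_block_mx R H m)) (B xi).

Definition model_step (R : realType) (H r m : nat)
    (a : 'cV[R]_(ext_dim H r m) -> 'cV[R]_r)
    (B : 'cV[R]_(ext_dim H r m) -> 'M[R]_(r, m))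
    (xi : 'cV[R]_(ext_dim H r m)) (u : 'cV[R]_m) : 'cV[R]_(ext_dim H r m) :=
  alpha a xi + beta B xi *m u.

Definition output_mx (R : realType) (H r m : nat) : 'M[R]_(r, ext_dim H r m) :=
  row_mx 0 1%:M.

Definition output (R : realType) (H r m : nat)
    (xi : 'cV[R]_(ext_dim H r m)) : 'cV[R]_r :=
  output_mx R H r m *m xi.

(* As [invmx] is total, this is the right pseudoinverse only when B has full
   row rank. *)
Definition right_pinv (R : realType) (r m : nat) (B : 'M[R]_(r, m)) :
    'M[R]_(m, r) :=
  B^T *m invmx (B *m B^T).

(* A feedback law [kappa] gives u_k = kappa xi_k v_k. *)
Definition io_linearizing (R : realType) (H r m : nat)
    (a : 'cV[R]_(ext_dim H r m) -> 'cV[R]_r)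
    (B : 'cV[R]_(ext_dim H r m) -> 'M[R]_(r, m))
    (D : set 'cV[R]_(ext_dim H r m))
    (Abar : 'M[R]_r) (Bbar : 'M[R]_(r, m))
    (kappa : 'cV[R]_(ext_dim H r m) -> 'cV[R]_m -> 'cV[R]_m) : Prop :=
  forall (xi : 'cV[R]_(ext_dim H r m)) (v : 'cV[R]_m), D xi ->
    output (model_step a B xi (kappa xi v)) = Abar *m output xi + Bbar *m v.

Definition io_linearization_achievable (R : realType) (H r m : nat)
    (a : 'cV[R]_(ext_dim H r m) -> 'cV[R]_r)
    (B : 'cV[R]_(ext_dim H r m) -> 'M[R]_(r, m))
    (D : set 'cV[R]_(ext_dim H r m))
    (Abar : 'M[R]_r) (Bbar : 'M[R]_(r, m)) : Prop :=
  exists kappa : 'cV[R]_(ext_dim H r m) -> 'cV[R]_m -> 'cV[R]_m,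
    io_linearizing a B D Abar Bbar kappa.

Definition linearizing_law (R : realType) (H r m : nat)
    (a : 'cV[R]_(ext_dim H r m) -> 'cV[R]_r)
    (B : 'cV[R]_(ext_dim H r m) -> 'M[R]_(r, m))
    (Abar : 'M[R]_r) (Bbar : 'M[R]_(r, m))
    (xi : 'cV[R]_(ext_dim H r m)) (v : 'cV[R]_m) : 'cV[R]_m :=
  right_pinv (B xi) *m (Abar *m output xi + Bbar *m v - a xi).

Definition history (R : realType) (H n : nat) (w : nat -> 'cV[R]_n) (k : nat) :
    'cV[R]_(H * n) :=
  castmx (sum_blocks H n, erefl 1%N) (\mxcol_(i < H) w (k + i)%N).

(* Time is shifted by H to stay in nat: [ext_state H z u k] is xi_{k+H}. *)
Definition ext_state (R : realType) (H r m : nat)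
    (z : nat -> 'cV[R]_r) (u : nat -> 'cV[R]_m) (k : nat) :
    'cV[R]_(ext_dim H r m) :=
  col_mx (col_mx (history H z k) (history H u k)) (z (k + H)%N).

Lemma output_ext_state (R : realType) (H r m : nat)
    (z : nat -> 'cV[R]_r) (u : nat -> 'cV[R]_m) (k : nat) :
  output (ext_state H z u k) = z (k + H)%N.
Proof. by rewrite /output mul_row_col mul0mx add0r mul1mx. Qed.

Lemma history_shift (R : realType) (H n : nat) (w : nat -> 'cV[R]_n) (k : nat) :
  shift_mx R H n *m history H w k + last_block_mx R H n *m w (k + H)%N =
  history H w k.+1.
Proof.
rewrite /shift_mx /last_block_mx /history.
case: _ / (sum_blocks H n); rewrite !castmx_id mul_mxblock_mxrow mxcol_mul.
rewrite -mxcolD; apply/eq_mxcol => i.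
have [iH|iH] := eqVneq i.+1 H.
  rewrite mul1mx big1 ?add0r => [|j _]; first by rewrite addSn -addnS iH.
  by rewrite iH ltn_eqF ?mul0mx.
have i1H : (i.+1 < H)%N by rewrite ltn_neqAle iH /=.
rewrite mul0mx addr0 (bigD1 (Ordinal i1H)) //= eqxx mul1mx big1 ?addr0.
  by rewrite addSn addnS.
by move=> j; rewrite -val_eqE /= => /negbTE ->; rewrite mul0mx.
Qed.

(* On an actual state/input sequence the model advances the memory by one
   step. *)
Lemma model_step_ext_state (R : realType) (H r m : nat)
    (a : 'cV[R]_(ext_dim H r m) -> 'cV[R]_r)
    (B : 'cV[R]_(ext_dim H r m) -> 'M[R]_(r, m))
    (z : nat -> 'cV[R]_r) (u : nat -> 'cV[R]_m) (k : nat) :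
  z (k + H).+1 =
    a (ext_state H z u k) + B (ext_state H z u k) *m u (k + H)%N ->
  model_step a B (ext_state H z u k) (u (k + H)%N) = ext_state H z u k.+1.
Proof.
rewrite /model_step /alpha /beta => zS.
have -> : block_shift R H r m *m ext_state H z u k =
    col_mx (col_mx (history H z k.+1) (shift_mx R H m *m history H u k)) 0.
  rewrite /block_shift /ext_state mul_block_col mul_block_col mul_col_mx.
  rewrite !mul0mx !addr0 !add0r add_col_mx addr0.
  by rewrite history_shift.
rewrite !mul_col_mx mul0mx -[X in col_mx X (a _)]col_mx0.
rewrite !add_col_mx !addr0 add0r -zS history_shift.
by rewrite /ext_state addSn.
Qed.

(* Main.v *)
Require Import Defs.
From mathcomp Require Import all_boot all_order all_algebra.
From mathcomp Require Import all_classical reals.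

Import GRing.Theory Num.Theory.

Local Open Scope ring_scope.

(** The last block row of the block shift is zero, so the memory never reaches
    the next output: y_(k+1) = a(xi_k) + B(xi_k) u_k exactly
    ([output_model_step]).  Linearization thus amounts to solving, at each
    state of the domain, the linear system
      B(xi) u = Abar y + Bbar v - a(xi),
    which the right pseudoinverse of B(xi) does as soon as B(xi) has full row
    rank ([mulmx_right_pinv]).  The latter rests on the invertibility of the
    Gram matrix B B^T, where the order of the scalars matters: a sum of squares
    vanishes only when each term does ([gram_unitmx]). *)

(** The diagonal entries of M M^T are the squared norms of the rows of M. *)
Lemma gram_eq0 (F : realDomainType) (p n : nat) (M : 'M[F]_(p, n)) :
  M *m M^T = 0 -> M = 0.
Proof.
move=> MMT0; apply/matrixP => i j; rewrite mxE.
have : \sum_k M i k ^+ 2 = 0.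
  have := congr1 (fun N : 'M[F]_p => N i i) MMT0; rewrite !mxE => {2}<-.
  by apply: eq_bigr => k _; rewrite mxE expr2.
move/psumr_eq0P => /(_ (fun k _ => sqr_ge0 (M i k)) j isT) /eqP.
by rewrite sqrf_eq0 => /eqP.
Qed.

(** If K spans the row kernel of B B^T, then (K B)(K B)^T = 0, so K B = 0, and
    K = 0 because the rows of B are independent. *)
Lemma gram_unitmx (F : realFieldType) (p n : nat) (B : 'M[F]_(p, n)) :
  row_free B -> B *m B^T \in unitmx.
Proof.
move=> Bfree; rewrite -row_free_unit -kermx_eq0.
set K := kermx _; apply/eqP/(row_free_inj Bfree); rewrite mul0mx.
apply: gram_eq0.
by rewrite trmx_mul mulmxA -(mulmxA K) mulmx_ker mul0mx.
Qed.

Lemma mulmx_right_pinv (R : realType) (p n : nat) (B : 'M[R]_(p, n)) :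
  row_free B -> B *m right_pinv B = 1%:M.
Proof. by move=> Bfree; rewrite mulmxA mulmxV ?gram_unitmx. Qed.

(** The output has relative degree one: the input acts on it directly through
    B, and the shifted memory does not act on it. *)
Lemma output_model_step (R : realType) (H r m : nat)
    (a : 'cV[R]_(ext_dim H r m) -> 'cV[R]_r)
    (B : 'cV[R]_(ext_dim H r m) -> 'M[R]_(r, m))
    (xi : 'cV[R]_(ext_dim H r m)) (u : 'cV[R]_m) :
  output (model_step a B xi u) = a xi + B xi *m u.
Proof.
rewrite /output /output_mx /model_step /alpha /beta /block_shift.
rewrite !mulmxDr !mulmxA mul_row_block !mul_row_col.
by rewrite !mul0mx !mulmx0 !mul1mx !add0r row_mx0 mul0mx add0r.
Qed.

Theorem proposition4 (R : realType) (H r m : nat)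
    (hH : (1 <= H)%N) (hr : (1 <= r)%N) (hm : (1 <= m)%N)
    (a : 'cV[R]_(ext_dim H r m) -> 'cV[R]_r)
    (B : 'cV[R]_(ext_dim H r m) -> 'M[R]_(r, m))
    (D : set 'cV[R]_(ext_dim H r m))
    (Abar : 'M[R]_r) (Bbar : 'M[R]_(r, m)) :
  (forall xi : 'cV[R]_(ext_dim H r m), D xi -> \rank (B xi) = r) ->
  io_linearization_achievable a B D Abar Bbar /\
  io_linearizing a B D Abar Bbar (linearizing_law a B Abar Bbar).
Proof.
move=> rankB.
have lawP : io_linearizing a B D Abar Bbar (linearizing_law a B Abar Bbar).
  move=> xi v Dxi; have Bfree : row_free (B xi) by apply/eqP/rankB.
  rewrite output_model_step /linearizing_law mulmxA mulmx_right_pinv //.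
  by rewrite mul1mx addrC subrK.
by split=> //; exists (linearizing_law a B Abar Bbar).
Qed.
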